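(* Let $\mathcal{A}$ be a normed algebra such that $\mathcal{A}^2$ has infinite co-dimension in $\mathcal{A}$. Then $N(\mathcal{A} \times_0 \mathbb{C})$ is infinite. Moreover, if $N_c(\mathcal{A})$ is non-empty, then $N_c(\mathcal{A} \times_0 \mathbb{C})$ is infinite.
   Context: Algebras are associative algebras over $\mathbb{C}$ (not assumed unital or commutative). An algebra norm on an algebra $\mathcal{A}$ is a vector space norm $\|\cdot\|$ on $\mathcal{A}$ that is submultiplicative, i.e. $\|ab\| \le \|a\|\|b\|$ for all $a,b \in \mathcal{A}$ (completeness is not required); a normed algebra is an algebra with an algebra norm. $N(\mathcal{A})$ denotes the set of equivalence classes of all algebra norms on $\mathcal{A}$, and $N_c(\mathcal{A})$ the set of equivalence classes of all complete algebra norms (Banach algebra norms) on $\mathcal{A}$, where two norms are identified if they are equivalent (induce the same topology). $\mathcal{A}^2 = \operatorname{span}\{ab : a,b \in \mathcal{A}\}$, and its co-dimension is the dimension of the vector space $\mathcal{A}/\mathcal{A}^2$. The null product algebra $\mathcal{A} \times_0 \mathbb{C}$ is the vector space $\mathcal{A} \times \mathbb{C}$ with coordinatewise linear operations and the product $(a,\alpha) \times_0 (b,\beta) = (ab, 0)$. *)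

(* Defs.v *)
From HB Require Import structures.
From mathcomp Require Import all_boot all_order all_algebra generic_quotient ring_quotient.
From mathcomp Require Import complex.
From mathcomp Require Import all_classical all_reals all_analysis.

Set Implicit Arguments.
Unset Strict Implicit.
Unset Printing Implicit Defensive.

Import Order.TTheory GRing.Theory Num.Theory.
Import numFieldNormedType.Exports.

Local Open Scope classical_set_scope.
Local Open Scope ring_scope.
Local Open Scope quotient_scope.

(* MathComp rings are unital; this is an associative algebra without the
   assumption of a unit. *)
HB.mixin Record Lmodule_isAssocAlgebra (K : pzRingType) A
    & GRing.Lmodule K A := {
  amul : A -> A -> A;
  amulA : associative amul;
  amulDl : left_distributive amul +%R;
  amulDr : right_distributive amul +%R;
  amulZl : forall (c : K) (a b : A), amul (c *: a) b = c *: amul a b;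
  amulZr : forall (c : K) (a b : A), amul a (c *: b) = c *: amul a b
}.

#[short(type="assocAlgType")]
HB.structure Definition AssocAlgebra (K : pzRingType) :=
  {A of Lmodule_isAssocAlgebra K A & GRing.Lmodule K A}.

Section LinearSpan.
Variables (K : pzRingType) (V : lmodType K).

Definition lspan (S : set V) : set V :=
  [set x | exists (n : nat) (c : 'I_n -> K) (v : 'I_n -> V),
     (forall i, S (v i)) /\ x = \sum_(i < n) c i *: v i].

Lemma lspan0 S : lspan S 0.
Proof.
by exists 0, (fun=> 0), (fun=> 0); split=> [[]//|]; rewrite big_ord0.
Qed.

Lemma lspanZ S a x : lspan S x -> lspan S (a *: x).
Proof.
move=> [n [c [v [Sv ->]]]]; exists n, (fun i => a * c i), v; split=> //.
by rewrite scaler_sumr; apply: eq_bigr => i _; rewrite scalerA.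
Qed.

Lemma lspanD S x y : lspan S x -> lspan S y -> lspan S (x + y).
Proof.
move=> [n [c [v [Sv ->]]]] [m [d [w [Sw ->]]]].
exists (n + m)%N.
exists (fun i => match fintype.split i with inl j => c j | inr j => d j end).
exists (fun i => match fintype.split i with inl j => v j | inr j => w j end).
split=> [i|]; first by case: (fintype.split i).
rewrite big_split_ord /=; congr (_ + _); apply: eq_bigr => i _.
  by rewrite (unsplitK (inl i)).
by rewrite (unsplitK (inr i)).
Qed.

Definition in_lspan (S : set V) : {pred V} := fun x => `[< lspan S x >].

Lemma in_lspan_submod S : submod_closed (in_lspan S).
Proof.
split; first exact/asboolP/lspan0.
move=> a x y /asboolP Sx /asboolP Sy.
exact/asboolP/lspanD/Sy/lspanZ.
Qed.

HB.instance Definition _ S := GRing.isSubmodClosed.Build K V (in_lspan S)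
  (in_lspan_submod S).

Definition infinite_dim : Prop :=
  ~ exists s : seq V, lspan [set` s] = setT.

End LinearSpan.

(* ring_quotient only covers Z-modules and rings; the scaling is added here. *)
Section QuotientModule.
Variables (K : pzRingType) (V : lmodType K) (W : submodClosed V).

Definition submod_zmod : {pred V} := W.

Lemma submod_zmod_closed : zmod_closed submod_zmod.
Proof.
split=> [|x y Wx Wy]; first exact: (@rpred0 _ W).
by rewrite -scaleN1r; apply: (rpredD (S := W)) => //; apply: (rpredZ (s := W)).
Qed.

HB.instance Definition _ := GRing.isZmodClosed.Build V submod_zmod
  submod_zmod_closed.

Definition lquot : Type := Quotient.quot submod_zmod.

HB.instance Definition _ := GRing.Zmodule.on lquot.

Definition lquot_scale (a : K) (x : lquot) : lquot :=
  \pi_(Quotient.quot submod_zmod) (a *: repr (x : Quotient.quot submod_zmod)).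

Let pi (x : V) : lquot := \pi_(Quotient.quot submod_zmod) x.

Let piP (x : lquot) : exists y, x = pi y.
Proof. by exists (repr (x : Quotient.quot submod_zmod)); rewrite /pi reprK. Qed.

Let piD x y : pi x + pi y = pi (x + y).
Proof. exact/esym/(raddfD (\pi_(Quotient.quot submod_zmod))). Qed.

Lemma lquot_scale_pi a x : lquot_scale a (pi x) = pi (a *: x).
Proof.
apply/eqP; rewrite /lquot_scale -Quotient.idealrBE -scalerBr.
apply: (rpredZ (s := W)).
by rewrite -[_ \in _]/(_ \in submod_zmod) Quotient.idealrBE reprK.
Qed.

Lemma lquot_scaleA a b x :
  lquot_scale a (lquot_scale b x) = lquot_scale (a * b) x.
Proof. by have [y ->] := piP x; rewrite !lquot_scale_pi scalerA. Qed.

Lemma lquot_scale1 : left_id 1 lquot_scale.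
Proof. by move=> x; have [y ->] := piP x; rewrite lquot_scale_pi scale1r. Qed.

Lemma lquot_scaleDr : right_distributive lquot_scale +%R.
Proof.
move=> a x y; have [x' ->] := piP x; have [y' ->] := piP y.
by rewrite piD !lquot_scale_pi piD scalerDr.
Qed.

Lemma lquot_scaleDl x : {morph lquot_scale^~ x : a b / a + b}.
Proof.
by have [y ->] := piP x => a b; rewrite !lquot_scale_pi piD scalerDl.
Qed.

HB.instance Definition _ := GRing.Zmodule_isLmodule.Build K lquot
  lquot_scaleA lquot_scale1 lquot_scaleDr lquot_scaleDl.

End QuotientModule.

Definition alg_square (K : pzRingType) (A : assocAlgType K) : submodClosed A :=
  in_lspan [set amul a b | a in [set: A] & b in [set: A]].

Section NullProduct.
Variables (K : pzRingType) (A : assocAlgType K).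

Definition null_product : Type := (A * K^o)%type.

HB.instance Definition _ := GRing.Lmodule.on null_product.

Definition null_mul (x y : null_product) : null_product := (amul x.1 y.1, 0).

Lemma null_mulA : associative null_mul.
Proof. by move=> x y z; rewrite /null_mul /= amulA. Qed.

Lemma null_mulDl : left_distributive null_mul +%R.
Proof. by move=> x y z; congr (_, _); rewrite /= ?amulDl ?addr0. Qed.

Lemma null_mulDr : right_distributive null_mul +%R.
Proof. by move=> x y z; congr (_, _); rewrite /= ?amulDr ?addr0. Qed.

Lemma null_mulZl c x y : null_mul (c *: x) y = c *: null_mul x y.
Proof. by congr (_, _); rewrite /= ?amulZl ?scaler0. Qed.

Lemma null_mulZr c x y : null_mul x (c *: y) = c *: null_mul x y.
Proof. by congr (_, _); rewrite /= ?amulZr ?scaler0. Qed.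

HB.instance Definition _ := Lmodule_isAssocAlgebra.Build K null_product
  null_mulA null_mulDl null_mulDr null_mulZl null_mulZr.

End NullProduct.

(* As for the norms of the library, values are in the scalar field K. The axioms
   imply 0 <= anorm a, so for K = R[i] the values are nonnegative reals. *)
Record algebra_norm (K : numFieldType) (A : assocAlgType K) := AlgebraNorm {
  anorm :> A -> K;
  anormD : forall a b, anorm (a + b) <= anorm a + anorm b;
  anormZ : forall (c : K) a, anorm (c *: a) = `|c| * anorm a;
  anorm0_eq0 : forall a, anorm a = 0 -> a = 0;
  anormM : forall a b, anorm (amul a b) <= anorm a * anorm b
}.

Section NormedBy.
Variables (K : numFieldType) (A : assocAlgType K).

(* A copy of A carrying the norm p and the topology and uniformity it induces. *)
Definition normed_by (p : algebra_norm A) : Type := A.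

HB.instance Definition _ p := GRing.Lmodule.on (normed_by p).
HB.instance Definition _ p := Lmodule_isNormed.Build K (normed_by p)
  (@anormD K A p) (@anormZ K A p) (@anorm0_eq0 K A p).

Definition equivalent_norms (p q : algebra_norm A) : Prop :=
  (open : set (set (normed_by p))) = (open : set (set (normed_by q))).

Definition complete_norm (p : algebra_norm A) : Prop :=
  forall F : set_system (normed_by p), ProperFilter F -> cauchy F -> cvg F.

Definition norm_classes (P : set (algebra_norm A)) :
    set (set (algebra_norm A)) :=
  [set [set q | P q /\ equivalent_norms p q] | p in P].

End NormedBy.

Definition alg_norm_classes (K : numFieldType) (A : assocAlgType K) :
    set (set (algebra_norm A)) :=
  norm_classes [set: algebra_norm A].

Definition complete_norm_classes (K : numFieldType) (A : assocAlgType K) :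
    set (set (algebra_norm A)) :=
  norm_classes (@complete_norm K A).

Arguments alg_norm_classes {K} A.
Arguments complete_norm_classes {K} A.

(* Main.v *)
(* Let f be a linear functional on A that vanishes on A^2. Then
   (a, c) |-> p a + |c + f a| is an algebra norm on the null product, complete
   if p is, because it is the pullback of (a, c) |-> p a + |c| under an algebra
   automorphism. The norms given by f and g are equivalent only if f - g is
   p-bounded. As A / A^2 is infinite-dimensional, some f vanishing on A^2 is
   unbounded, and the norms given by 0, f, 2f, 3f, ... are pairwise
   inequivalent. *)

From HB Require Import structures.
Require Import Defs.
From mathcomp Require Import all_boot all_order all_algebra.
From mathcomp Require Import generic_quotient ring_quotient.
From mathcomp Require Import complex.
From mathcomp Require Import all_classical all_reals all_analysis.

Set Implicit Arguments.
Unset Strict Implicit.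
Unset Printing Implicit Defensive.

Import Order.TTheory GRing.Theory Num.Theory.
Import numFieldNormedType.Exports.

Local Open Scope classical_set_scope.
Local Open Scope ring_scope.
Local Open Scope quotient_scope.

(** * Linear spans *)

Section LinearSpanTheory.
Variables (K : pzRingType) (V : lmodType K).
Implicit Types (S : set V) (P : V -> Prop).

Lemma lspan_ind S P : P 0 -> (forall x y, P x -> P y -> P (x + y)) ->
  (forall c v, S v -> P (c *: v)) -> forall x, lspan S x -> P x.
Proof.
move=> P0 PD PZ _ [n [c [v [Sv ->]]]].
by elim/big_ind: _ => // i _; exact: PZ.
Qed.

Lemma mem_lspan S x : S x -> lspan S x.
Proof.
move=> Sx; exists 1, (fun=> 1), (fun=> x).
by split=> //; rewrite big_ord1 scale1r.
Qed.

Lemma sub_lspan S S' : S `<=` S' -> lspan S `<=` lspan S'.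
Proof.
by move=> SS' _ [n [c [v [Sv ->]]]]; exists n, c, v; split=> // i; apply/SS'.
Qed.

Lemma lspanU1 S a x : lspan (S `|` [set a]) x ->
  exists t u, lspan S u /\ x = t *: a + u.
Proof.
move: x; apply: lspan_ind => [|_ _ [t [u [Su ->]]] [r [v [Sv ->]]]|c v [Sv|->]].
- by exists 0, 0; rewrite scale0r addr0; split=> //; exact: lspan0.
- exists (t + r), (u + v); split; first exact: lspanD.
  by rewrite scalerDl addrACA.
- exists 0, (c *: v); rewrite scale0r add0r.
  by split=> //; exact/lspanZ/mem_lspan.
- by exists c, 0; rewrite addr0; split=> //; exact: lspan0.
Qed.

End LinearSpanTheory.

(** * Linear functionals vanishing on a subspace *)

Section Functionals.
Variables (K : fieldType) (V : lmodType K) (W : submodClosed V).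

(** A linear extension is built through its graph, which is the span of these pairs once that span
    is single-valued and lies over all of [V]. *)
Definition prescribed_graph (g : V -> K) (B : set V) : set (V * K^o)%type :=
  [set z | (z.1 \in W /\ z.2 = 0) \/ (B z.1 /\ z.2 = g z.1)].

(* Linear independence of B modulo W, in the form used for extensions: any
   values on B together with 0 on W span the graph of a function. *)
Definition independent_mod (B : set V) : Prop :=
  forall g c, lspan (prescribed_graph g B) (0, c) -> c = 0.

Lemma sub_prescribed_graph g B B' :
  B `<=` B' -> prescribed_graph g B `<=` prescribed_graph g B'.
Proof. by move=> BB' z [?|[/BB' ? ?]]; [left|right]. Qed.

Lemma lspan_prescribed_graph_fst g B z :
  lspan (prescribed_graph g B) z -> lspan ([set` W] `|` B) z.1.
Proof.
move: z; apply: lspan_ind => [|x y|c v Sv] /=.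
- exact: lspan0.
- exact: lspanD.
- by apply/lspanZ/mem_lspan; case: Sv => -[]; [left|right].
Qed.

Lemma lspan_prescribed_graphP g B x : lspan ([set` W] `|` B) x ->
  exists c, lspan (prescribed_graph g B) (x, c).
Proof.
move: x; apply: lspan_ind => [|x y [c Sc] [d Sd]|c v [Wv|Bv]] /=.
- by exists 0; exact: lspan0.
- by exists (c + d); exact: (lspanD Sc Sd).
- exists (c *: (0 : K^o)); apply: (@lspanZ _ (V * K^o)%type _ c (v, 0)).
  by apply: mem_lspan; left.
- exists (c *: (g v : K^o)); apply: (@lspanZ _ (V * K^o)%type _ c (v, g v)).
  by apply: mem_lspan; right.
Qed.

Lemma independent_mod_set0 : independent_mod set0.
Proof.
suff z20 g z : lspan (prescribed_graph g set0) z -> z.2 = 0.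
  by move=> g c /z20.
move: z; apply: lspan_ind => [//|x y /= -> ->|a v [[_ v0]|[]]] //=.
  by rewrite addr0.
by rewrite v0 scaler0.
Qed.

(** The chain condition for Zorn's lemma: an element of the span involves finitely many vectors, so
    one member of the chain already accounts for it. *)
Lemma independent_mod_bigcup (F : set (set V)) :
  F `<=` independent_mod -> total_on F subset ->
  independent_mod (\bigcup_(X in F) X).
Proof.
move=> Findep Ftot g c Sc.
(* Adding [set0] keeps a chain and provides a member even when [F] is empty. *)
pose F' := F `|` [set set0].
have F'tot X Y : F' X -> F' Y -> X `<=` Y \/ Y `<=` X.
  by move=> [FX|->] [FY|->]; [exact: Ftot|right|left|left] => //;
    apply: sub0set.
have : exists2 X, F' X & lspan (prescribed_graph g X) (0, c).
  move: (_, c) Sc => z; move: z.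
  apply: lspan_ind => [|x y [X FX Sx] [Y FY Sy]|a v [Wv|[[X FX Xv] vg]]].
  - by exists set0; [right|exact: lspan0].
  - have [XY|YX] := F'tot _ _ FX FY.
      exists Y => //; apply: lspanD => //.
      by apply: sub_lspan Sx; exact: sub_prescribed_graph.
    exists X => //; apply: lspanD => //.
    by apply: sub_lspan Sy; exact: sub_prescribed_graph.
  - by exists set0; [right|apply/lspanZ/mem_lspan; left].
  - by exists X; [left|apply/lspanZ/mem_lspan; right].
move=> [X [FX|->]]; first exact: (Findep _ FX).
exact: independent_mod_set0.
Qed.

(** A relation with a nonzero coefficient on [a] could be solved for [a], placing it in the span of
    [W] and [B]. *)
Lemma independent_modU1 B a : independent_mod B ->
  ~ lspan ([set` W] `|` B) a -> independent_mod (B `|` [set a]).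
Proof.
move=> Bindep aB g c Sc.
have : lspan (prescribed_graph g B `|` [set ((a, g a) : V * K^o)]) (0, c).
  apply: sub_lspan Sc => -[x d] [Wx|[/= [Bx|->] ->]]; last by right.
    by left; left.
  by left; right.
move=> /lspanU1[t [[u1 u2] [Su]]] /=.
have [->|t0 [/esym/eqP + _]] := eqVneq t 0.
  by rewrite scale0r add0r => uE; apply: (Bindep g); rewrite uE.
rewrite addrC addr_eq0 => /eqP u1E; exfalso; apply: aB.
have -> : a = - t^-1 *: u1.
  by rewrite u1E scalerN scaleNr opprK scalerA mulVf // scale1r.
exact/lspanZ/(lspan_prescribed_graph_fst Su).
Qed.

(** A maximal independent set spans, since a vector outside the span could be adjoined. *)
Lemma exists_basis_mod : exists2 B,
  independent_mod B & forall x, lspan ([set` W] `|` B) x.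
Proof.
have [B [Bindep Bmax]] := Zorn_bigcup independent_mod_bigcup.
exists B => // x; apply: contrapT => Bx.
apply: (Bmax (B `|` [set x])); last exact: independent_modU1.
split; first by left.
by move=> /(_ x (or_intror erefl)) Bx'; apply/Bx/mem_lspan; right.
Qed.

(** The projection kills [W], so the image of a finite [B] would span the quotient. *)
Lemma basis_mod_infinite B : infinite_dim (lquot W) ->
  (forall x, lspan ([set` W] `|` B) x) -> infinite_set B.
Proof.
move=> Winf Bspan /finite_seqP[s Bs]; apply: Winf.
pose pi (x : V) : lquot W := \pi_(Quotient.quot (submod_zmod W)) x.
exists (map pi s); apply/seteqP; split=> // q _.
have -> : q = pi (repr (q : Quotient.quot (submod_zmod W))).
  by rewrite /pi reprK.
move: (repr _) (Bspan (repr (q : Quotient.quot (submod_zmod W)))) => x; move: x.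
apply: lspan_ind => [|x y Sx Sy|c v vWB].
- have -> : pi 0 = 0 by apply: raddf0.
  exact: lspan0.
- have -> : pi (x + y) = pi x + pi y by apply: raddfD.
  exact: lspanD.
have <- : c *: pi v = pi (c *: v) by exact: lquot_scale_pi.
case: vWB => [Wv|]; last first.
  by rewrite Bs => vs; apply/lspanZ/mem_lspan/map_f.
have -> : pi v = 0.
  have -> : 0 = pi 0 by apply/esym; apply: raddf0.
  by apply/eqP; rewrite -Quotient.idealrBE subr0.
by rewrite scaler0; exact: lspan0.
Qed.

(** Two pairs of the span over the same [x] differ by a pair over 0, so the span is single-valued;
    linearity is its closure under combinations. *)
Lemma functional_of_graph (G : set (V * K^o)%type) :
  (forall x, exists c, lspan G (x, c)) ->
  (forall c, lspan G (0, c) -> c = 0) ->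
  exists f : {linear V -> K^o}, forall x c, lspan G (x, c) -> f x = c.
Proof.
move=> /choice[f fG] G0.
have fE x c : lspan G (x, c) -> f x = c.
  move=> Gc; apply/eqP; rewrite -subr_eq0; apply/eqP/G0.
  have := lspanD (fG x) (lspanZ (-1) Gc).
  by rewrite scaleN1r -[_ + _]/(x - x, f x - c) subrr.
have flin : linear f.
  by move=> a x y; apply: fE; have := lspanD (lspanZ a (fG x)) (fG y).
pose fL := GRing.isLinear.Build _ _ _ _ f flin.
pose F : {linear V -> K^o} := HB.pack f fL.
by exists F.
Qed.

(** [e] lists distinct elements of an infinite basis modulo [W], on which values are free. *)
Lemma infinite_codim_functionals : infinite_dim (lquot W) ->
  exists e : nat -> V, forall h : nat -> K, exists f : {linear V -> K^o},
    (forall x, x \in W -> f x = 0) /\ (forall n, f (e n) = h n).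
Proof.
move=> Winf; have [B Bindep Bspan] := exists_basis_mod.
have /infiniteP/card_leP/unsquash i := basis_mod_infinite Winf Bspan.
pose e n := val (i (exist _ n (mem_set I))).
have eB n : B (e n) by exact: set_valP.
have einj : injective e.
  by move=> m n /val_inj/(inj (mem_set I) (mem_set I)) /(congr1 val).
exists e => h.
(* [h] transported along the injective [e], with 0 off its range. *)
pose g x := if pselect (exists n, e n = x) is left ex then h (projT1 (cid ex))
            else 0.
have ge n : g (e n) = h n.
  rewrite /g; case: pselect => [ex|[]]; last by exists n.
  by case: (cid ex) => m /= /einj ->.
have [f fE] := functional_of_graph
  (fun x => lspan_prescribed_graphP g (Bspan x)) (Bindep g).
exists f; split=> [x Wx|n]; apply/fE/mem_lspan; first by left.
by right; rewrite /= ge.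
Qed.

End Functionals.

(** * Comparison and completeness of algebra norms *)

Section AlgebraNormTheory.
Variables (K : numFieldType) (A : assocAlgType K).
Implicit Types p q : algebra_norm A.

Lemma anorm_ge0 p a : 0 <= p a.
Proof. exact: (normr_ge0 (a : normed_by p)). Qed.

Lemma anorm0 p : p 0 = 0.
Proof. exact: (normr0 (normed_by p)). Qed.

Lemma anorm_gt0 p a : a != 0 -> 0 < p a.
Proof.
move=> a0; rewrite lt_def anorm_ge0 andbT.
by apply: contra_neq a0; exact: anorm0_eq0.
Qed.

Lemma equivalent_norms_sym p q : equivalent_norms p q -> equivalent_norms q p.
Proof. by move=> ?; exact: esym. Qed.

(** The open unit ball of [q] is [p]-open, so it contains a [p]-ball around 0; homogeneity does the
    rest. *)
Lemma equivalent_norms_bounded p q : equivalent_norms p q ->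
  exists C, forall a, q a <= C * p a.
Proof.
move=> pq.
have oq : open ([set a | q a < 1] : set (normed_by q)).
  rewrite (_ : mkset _ = ball (0 : normed_by q) 1); first exact: ball_open.
  by apply/seteqP; split=> a; rewrite -ball_normE /= sub0r normrN.
have op : open ([set a | q a < 1] : set (normed_by p)) by rewrite pq.
have : nbhs (0 : normed_by p) [set a | q a < 1].
  by apply: open_nbhs_nbhs; split; rewrite //= anorm0 ltr01.
move=> /nbhs_norm0P[r /= r0 rP]; exists (2 / r) => a.
have [->|a0] := eqVneq a 0; first by rewrite !anorm0 mulr0.
have pa0 := anorm_gt0 p a0.
(* This scales [a] to [p]-norm [r / 2], strictly below [r], whence the constant [2 / r]. *)
pose c := r / 2 / p a.
have c0 : 0 < c by rewrite !divr_gt0.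
have /rP /= : p (c *: a) < r.
  rewrite anormZ (gtr0_norm c0) mulfVK ?gt_eqF//.
  by rewrite ltr_pdivrMr // mulr_natr mulr2n ltrDl.
rewrite anormZ (gtr0_norm c0) mulrC -ltr_pdivlMr // mul1r => /ltW.
by rewrite !invf_div mulrA [_ * 2]mulrC mulrAC.
Qed.

(** Stated by inequalities on [A] itself, so that filters can be pushed along coordinate maps. *)
Lemma complete_normP p : complete_norm p <->
  (forall F : set_system A, ProperFilter F ->
    (forall e, 0 < e -> exists x, F [set y | p (x - y) < e]) ->
    exists x, forall e, 0 < e -> F [set y | p (x - y) < e]).
Proof.
have ballE (x : normed_by p) e : ball x e = [set y | p (x - y) < e].
  by rewrite -ball_normE.
split=> cp F FF Fc.
  have /cvg_ex[x /fcvg_ballP Fx] : cvg (F : set_system (normed_by p)).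
    apply: cp; apply/cauchyP => e /Fc[x Fx]; exists x.
    by rewrite ballE.
  by exists x => e /Fx; rewrite /prop_near1 /= ballE.
have [e /(proj1 (cauchyP F) Fc)[x]|x Fx] := cp F FF.
  by rewrite ballE; exists x.
apply/cvg_ex; exists x; apply/fcvg_ballP => e /Fx.
by rewrite /prop_near1 ballE.
Qed.

End AlgebraNormTheory.

(** * Twisted norms on the null product *)

Section TwistedNorm.
Variables (K : numFieldType) (A : assocAlgType K) (p : algebra_norm A).
Variables (f : {linear A -> K^o}).
Variables (f0 : forall x, x \in alg_square A -> f x = 0).

Definition twist (x : null_product A) : K := p x.1 + `|x.2 + f x.1|.

Lemma twistD x y : twist (x + y) <= twist x + twist y.
Proof.
rewrite /twist addrACA lerD ?anormD//=.
by rewrite linearD addrACA ler_normD.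
Qed.

Lemma twistZ c x : twist (c *: x) = `|c| * twist x.
Proof. by rewrite /twist /= anormZ linearZ -scalerDr normrM mulrDr. Qed.

Lemma twist0_eq0 x : twist x = 0 -> x = 0.
Proof.
move=> /eqP; rewrite paddr_eq0 ?anorm_ge0// => /andP[/eqP/anorm0_eq0 x10].
rewrite x10 linear0 addr0 normr_eq0 => /eqP x20.
by case: x x10 x20 => x1 x2 /= -> ->.
Qed.

(** The functional term of a product vanishes: its second coordinate is 0 and its first lies in
    [alg_square A]. *)
Lemma twistM x y : twist (amul x y) <= twist x * twist y.
Proof.
rewrite /twist /= f0; last first.
  by apply/asboolP/mem_lspan; exists x.1 => //; exists y.1.
rewrite addr0 normr0 addr0 (le_trans (anormM p _ _))//.
by rewrite ler_pM ?anorm_ge0// lerDl.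
Qed.

Definition twisted_norm : algebra_norm (null_product A) :=
  AlgebraNorm twistD twistZ twist0_eq0 twistM.

End TwistedNorm.

Lemma twisted_norm_equivalent (K : numFieldType) (A : assocAlgType K)
    (p : algebra_norm A) (f g : {linear A -> K^o})
    (f0 : forall x, x \in alg_square A -> f x = 0)
    (g0 : forall x, x \in alg_square A -> g x = 0) :
  equivalent_norms (twisted_norm p f0) (twisted_norm p g0) ->
  exists C, forall a, `|f a - g a| <= C * p a.
Proof.
move=> /equivalent_norms_sym/equivalent_norms_bounded[C fgC].
(* This vector annihilates the functional term of the [g]-norm and turns that of the [f]-norm into
   [f a - g a]. *)
exists C => a; have := fgC (a, - g a).
rewrite /= /twist /= addNr normr0 addr0 addrC [- _ + _]addrC.
by apply: le_trans; rewrite lerDl anorm_ge0.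
Qed.

(** * Completeness of the complex numbers and of twisted norms *)

Section Complex.
Variable R : realType.
Local Open Scope complex_scope.

Lemma gt0_realC (e : R[i]) : 0 < e -> exists2 r : R, 0 < r & e = r%:C.
Proof.
by case: e => a b; rewrite ltcE /= => /andP[/eqP -> a0]; exists a.
Qed.

Lemma normc_i : `|'i%C : R[i]| = 1.
Proof. by rewrite normc_def /= expr0n expr1n add0r sqrtr1. Qed.

Lemma normc_le_ReIm (z : R[i]) : `|z| <= (`|complex.Re z| + `|complex.Im z|)%:C.
Proof.
rewrite {1}[z]complexE.
rewrite (le_trans (ler_normD _ _))// normrM !normc_def /=.
rewrite !expr0n !expr1n !addr0 add0r !sqrtr_sqr sqrtr1 mul1r -rmorphD /=.
exact: lexx.
Qed.

(** Up to sign, [Im z] is the real part of [z * 'i], and ['i] has modulus 1. *)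
Lemma normc_ge_Im (z : R[i]) : `|complex.Im z|%:C <= `|z|.
Proof.
by have := normc_ge_Re (z * 'i%C); rewrite ReiNIm normrN normrM normc_i mulr1.
Qed.

Lemma real_complete (F : set_system R) : ProperFilter F ->
  (forall e, 0 < e -> exists x, F [set y | `|x - y| < e]) ->
  exists x, forall e, 0 < e -> F [set y | `|x - y| < e].
Proof.
move=> FF Fc.
have /cauchy_cvg/cvg_ex[x /fcvg_ballP Fx] : cauchy F by apply/cauchyP.
by exists x.
Qed.

Lemma complex_complete (F : set_system R[i]) : ProperFilter F ->
  (forall e : R[i], 0 < e -> exists x, F [set y | `|x - y| < e]) ->
  exists x, forall e, 0 < e -> F [set y | `|x - y| < e].
Proof.
move=> FF Fc.
have [e e0|a Fa] := @real_complete (@complex.Re R @ F).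
  have /Fc[x Fx] : 0 < e%:C by rewrite ltcR.
  exists (complex.Re x); apply: (@filterS _ F _ _ _ _ Fx) => y /= xye.
  rewrite -ltcR; apply: le_lt_trans xye.
  by have := normc_ge_Re (x - y); rewrite raddfB.
have [e e0|b Fb] := @real_complete (@complex.Im R @ F).
  have /Fc[x Fx] : 0 < e%:C by rewrite ltcR.
  exists (complex.Im x); apply: (@filterS _ F _ _ _ _ Fx) => y /= xye.
  rewrite -ltcR; apply: le_lt_trans xye.
  by have := normc_ge_Im (x - y); rewrite raddfB.
exists (Complex a b) => _ /gt0_realC[e e0 ->].
have e20 : 0 < e / 2 by rewrite divr_gt0.
apply: (@filterS2 _ F _ _ _ _ _ (Fa _ e20) (Fb _ e20)) => -[c d] /= ac bd.
rewrite (le_lt_trans (normc_le_ReIm _))// ltcR (splitr e).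
exact: ltrD.
Qed.

End Complex.

(** The norm controls [x.1] and [x.2 + f x.1], so both push [F] to Cauchy filters; it need not
    control [x.2], as [f] may be unbounded. *)
Lemma twisted_norm_complete (R : realType) (A : assocAlgType R[i])
    (p : algebra_norm A) (f : {linear A -> R[i]^o})
    (f0 : forall x, x \in alg_square A -> f x = 0) :
  complete_norm p -> complete_norm (twisted_norm p f0).
Proof.
move=> /complete_normP cp; apply/complete_normP => F FF Fc.
have [e /Fc[x Fx]|a Fa] := cp (fst @ F).
- exists x.1; apply: (@filterS _ F _ _ _ _ Fx) => y /=; apply: le_lt_trans.
  by rewrite /twist lerDl.
have [e /Fc[x Fx]|b Fb] :=
    @complex_complete R ((fun x : null_product A => x.2 + f x.1) @ F).
- exists (x.2 + f x.1).
  apply: (@filterS _ F _ _ _ _ Fx) => y /=; apply: le_lt_trans.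
  by rewrite /twist /= linearB addrACA -opprD lerDr anorm_ge0.
(* The second coordinate solves [x.2 + f x.1 = b] at [x.1 = a]. *)
exists (a, b - f a) => e e0.
have e20 : 0 < e / 2 by rewrite divr_gt0.
apply: (@filterS2 _ F _ _ _ _ _ (Fa _ e20) (Fb _ e20)) => -[c d] /= ac bd.
rewrite /twist /= linearB addrACA subrK (splitr e) -opprD.
exact: ltrD.
Qed.

(** * Infinitely many inequivalent norms *)

Section InequivalentTwists.
Variables (R : realType) (A : assocAlgType R[i]) (p : algebra_norm A).
Hypothesis codim_inf : infinite_dim (lquot (alg_square A)).

Lemma unbounded_functional : exists f : {linear A -> R[i]^o},
  (forall x, x \in alg_square A -> f x = 0) /\
  ~ exists C, forall a, `|f a| <= C * p a.
Proof.
have [e eP] := infinite_codim_functionals codim_inf.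
(* Some functional equals 1 at [e n]; being nonzero lets [p (e n)] be cancelled below. *)
have e0 n : e n != 0.
  have [f [_ fe]] := eP (fun=> 1).
  apply/eqP => en0; have := fe n; rewrite en0 linear0 => /esym/eqP.
  by rewrite oner_eq0.
(* With these values a bound [C] would dominate every natural number. *)
have [f [f0 fe]] := eP (fun n => n%:R * p (e n)).
exists f; split=> // -[C fC].
have nC n : n%:R <= C.
  have := fC (e n); rewrite fe normrM normr_nat ger0_norm ?anorm_ge0//.
  by rewrite ler_pM2r ?anorm_gt0.
(* The order of [R[i]] compares real parts, and this natural number exceeds that of [C]. *)
have := nC (Num.truncn (complex.Re C)).+1.
rewrite lecE => /andP[_].
rewrite -[_.+1%:R](rmorph_nat (real_complex R)) /= leNgt.
by rewrite truncnS_gt.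
Qed.

(** [P] is left abstract to serve both for all norms and for complete ones. *)
Lemma infinite_norm_classes (P : set (algebra_norm (null_product A))) :
  (forall f : {linear A -> R[i]^o},
     forall f0 : (forall x, x \in alg_square A -> f x = 0),
     P (twisted_norm p f0)) ->
  infinite_set (norm_classes P).
Proof.
move=> PT; have [f [f0 fub]] := unbounded_functional.
pose fn n : {linear A -> R[i]^o} := n%:R \*: f.
have fn0 n x : x \in alg_square A -> fn n x = 0.
  by move=> /f0 fx; rewrite /= fx scaler0.
pose cl n := [set q | P q /\ equivalent_norms (twisted_norm p (@fn0 n)) q].
have clinj : injective cl.
  (* Equal classes make the twists by [m f] and [n f] equivalent, so [(m - n) f] is bounded; for
     [m != n] division bounds [f] itself. *)
  move=> m n clmn; have : cl m (twisted_norm p (@fn0 n)).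
    by rewrite clmn; split; [exact: PT|].
  move=> [_ /twisted_norm_equivalent[C fC]].
  apply/eqP; apply: contrapT => /negP mn; apply: fub.
  have mn0 : 0 < `|m%:R - n%:R : R[i]|.
    by rewrite normr_gt0 subr_eq0 eqr_nat.
  exists (C / `|m%:R - n%:R|) => a.
  rewrite mulrAC ler_pdivlMr // mulrC -normrM mulrBl; exact: fC.
apply: (@sub_infinite_set _ (range cl)).
  by move=> _ [n _ <-]; exists (twisted_norm p (@fn0 n)).
rewrite (eq_finite_set (inj_card_eq (in2W clinj))); exact: infinite_nat.
Qed.

End InequivalentTwists.

Theorem theorem2p17 (R : realType) (A : assocAlgType R[i]) (p : algebra_norm A)
    (codim_inf : infinite_dim (lquot (alg_square A))) :
  infinite_set (alg_norm_classes (null_product A)) /\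
  (complete_norm_classes A !=set0 ->
   infinite_set (complete_norm_classes (null_product A))).
Proof.
split; first exact: (infinite_norm_classes (p := p)).
(* The twists are now based on a complete norm [q], hence complete. *)
move=> [_ [q cq _]]; apply: (infinite_norm_classes (p := q)) => // f f0.
exact: twisted_norm_complete.
Qed.
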